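(* Let $\mathcal{C}$ be the class of all bivariate copulas. Then $$\{(\xi(C),\beta(C)) : C\in\mathcal{C}\}=\{(x,y)\in[0,1]\times[-1,1] : |y|^3\le 2x\}.$$ Moreover, the left boundary $\xi=|\beta|^3/2$ is attained uniquely by the copulas $(L_b)_{b\in[-1,1]}$: for every $b\in[-1,1]$, $L_b$ is a copula with $\beta(L_b)=b$ and $\xi(L_b)=|b|^3/2$, and it is the only copula $C\in\mathcal{C}$ with $\beta(C)=b$ and $\xi(C)=|b|^3/2$. The right boundary $\xi=1$ is attained by deterministic measure-preserving copulas: for every $b\in[-1,1]$ there is a Lebesgue-measure-preserving map $f\colon[0,1]\to[0,1]$ such that the copula $D$ of $(U,f(U))$, with $U$ uniform on $(0,1)$, satisfies $\xi(D)=1$ and $\beta(D)=b$.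
   Context: A bivariate copula is a function $C\colon[0,1]^2\to[0,1]$ with $C(u,0)=C(0,v)=0$, $C(u,1)=u$, $C(1,v)=v$ for all $u,v\in[0,1]$, and $C(v_1,v_2)-C(u_1,v_2)-C(v_1,u_2)+C(u_1,u_2)\ge 0$ whenever $u_1\le v_1$, $u_2\le v_2$. Equivalently, it is the restriction to $[0,1]^2$ of the joint distribution function of a random pair with marginals uniform on $(0,1)$. Chatterjee's rank correlation of a copula $C$ is $$\xi(C)=6\int_0^1\int_0^1(\partial_1C(u,v))^2\,\mathrm{d}u\,\mathrm{d}v-2,$$ where the partial derivative in the first argument is understood almost everywhere. Blomqvist's beta is $\beta(C)=4C(\tfrac12,\tfrac12)-1$. For $b\in[-1,1]$ put $r=|b|$ and $\varepsilon=\operatorname{sgn}(b)$ (with $\operatorname{sgn}(0)=0$), and define, with $(x)_+=\max\{x,0\}$, $$g_b(v)=\varepsilon\Bigl(\tfrac r2-\bigl|v-\tfrac12\bigr|\Bigr)_+\quad(0\le v\le 1),\qquad \ell(u)=\min\{u,1-u\}\quad(0\le u\le1),$$ $$L_b(u,v)=uv+\ell(u)\,g_b(v),\qquad (u,v)\in[0,1]^2.$$ *)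

(* Defs.v *)
From HB Require Import structures.
From mathcomp Require Import all_boot all_order all_algebra.
From mathcomp Require Import all_classical all_reals all_analysis.

Set Implicit Arguments.
Unset Strict Implicit.
Unset Printing Implicit Defensive.

Import Order.TTheory GRing.Theory Num.Theory.
Import numFieldNormedType.Exports.

Local Open Scope classical_set_scope.
Local Open Scope ring_scope.

(* A function on [0,1]^2 is represented by a function R -> R -> R of which
   only the values on [0,1]^2 matter; correspondingly, equality of copulas is
   [eq_on_square]. *)
Definition copula (R : realType) : set (R -> R -> R) := [set C |
  [/\ {in `[0, 1] & `[0, 1], forall u v, 0 <= C u v <= 1},
      {in `[0, 1], forall u, C u 0 = 0 /\ C u 1 = u},
      {in `[0, 1], forall v, C 0 v = 0 /\ C 1 v = v} &
      {in `[0, 1] & `[0, 1], forall u1 v1, {in `[0, 1] & `[0, 1],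
        forall u2 v2, u1 <= v1 -> u2 <= v2 ->
          0 <= C v1 v2 - C u1 v2 - C v1 u2 + C u1 u2}}]].

Definition eq_on_square (R : realType) (C D : R -> R -> R) : Prop :=
  {in `[0, 1] & `[0, 1], forall u v, C u v = D u v}.

(* For fixed v in [0,1], u |-> C u v is monotone on [0,1], hence differentiable
   at almost every u in ]0,1[. The operator [derive1] is total: its value where
   the derivative does not exist, and at u = 0 and u = 1, where it may see
   values of C off the square, does not affect the inner integral. *)
Definition partial1 (R : realType) (C : R -> R -> R) (u v : R) : R :=
  derive1 (C ^~ v) u.

Definition chatterjee_xi (R : realType) (C : R -> R -> R) : R :=
  6 * (\int[lebesgue_measure]_(v in `[0, 1])
         (\int[lebesgue_measure]_(u in `[0, 1]) (partial1 C u v) ^+ 2)) - 2.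

Definition blomqvist_beta (R : realType) (C : R -> R -> R) : R :=
  4 * C (2^-1) (2^-1) - 1.

Definition g_fun (R : realType) (b v : R) : R :=
  Num.sg b * Num.max (`|b| / 2 - `|v - 2^-1|) 0.

Definition tent (R : realType) (u : R) : R := Num.min u (1 - u).

Definition L_copula (R : realType) (b u v : R) : R :=
  u * v + tent u * g_fun b v.

Definition uniform01 (R : realType) (d : measure_display)
    (T : measurableType d) (P : probability T R) (X : {RV P >-> R}) : Prop :=
  forall A : set R, measurable A ->
    distribution P X A = uniform_prob (@ltr01 R) A.

Definition copula_of (R : realType) (d : measure_display)
    (T : measurableType d) (P : probability T R) (X Y : {RV P >-> R})
    (C : R -> R -> R) : Prop :=
  [/\ uniform01 X, uniform01 Y, copula C &
      {in `[0, 1] & `[0, 1], forall u v,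
        P [set w | X w <= u /\ Y w <= v] = (C u v)%:E}].

(* A measure-preserving map of [0,1] is represented by a measurable extension
   to R, which exists for every Borel map of [0,1]. *)
Definition preserves_lebesgue01 (R : realType) (f : {mfun R >-> R}) : Prop :=
  {in `[0, 1], forall x, f x \in `[0, 1]} /\
  forall A : set R, measurable A -> A `<=` `[0, 1] ->
    lebesgue_measure (`[0, 1] `&` f @^-1` A) = lebesgue_measure A.

(* Main.v *)
Require Import Defs.
From HB Require Import structures.
From mathcomp Require Import all_boot all_order all_algebra.
From mathcomp Require Import all_classical all_reals all_analysis.
From mathcomp Require Import measurable_realfun ring lra.

Set Implicit Arguments.
Unset Strict Implicit.
Unset Printing Implicit Defensive.

Import Order.TTheory GRing.Theory Num.Theory.
Import numFieldNormedType.Exports.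

Local Open Scope classical_set_scope.
Local Open Scope ring_scope.

(** For a copula C and a fixed v, the function u |-> C u v is nondecreasing and
    1-Lipschitz on [0,1]; call the integral of the square of its derivative its
    energy.  Then xi(C) = 6 * (integral over v of the energy) - 2, and everything
    rests on the fact [slope01_density] that such a function is the integral of
    its almost-everywhere derivative, a derivative that lies in [0,1].

    Bounds.  As the derivative lies in [0,1], the energy is at most
    C 1 v - C 0 v = v, whence xi <= 1.  On an interval it is at least
    (increment)^2 / (length), because x^2 >= 2 c x - c^2; cutting [0,1] at 1/2
    gives energy >= v^2 + 4 d(v)^2 with d(v) = C 1/2 v - v / 2.  The function d
    equals beta / 4 at 1/2, and it is 1/2-Lipschitz since v |-> C 1/2 v has slopes
    in [0,1].  Hence 2 |d(v)| >= |g_b(v)| with b = beta, and integrating yields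
    xi >= |b|^3 / 2 ([xi_ge]).

    Uniqueness.  Cutting one of the two halves again at a point u adds to the lower
    bound a multiple of the squared height of C u v above the chord
    ([energy_refined]).  If xi = |b|^3 / 2, the continuous nonnegative function
    v |-> 4 d(v)^2 - g_b(v)^2 + 8 (height)^2 has integral 0, so it vanishes: C is
    affine in u on both halves with the midpoint value of L_b ([xi_min_unique]).

    Attainment.  The rotation x |-> x + theta modulo 1 preserves Lebesgue measure,
    the copula D of (U, rotation of U) has its u-derivative in {0,1}, so its energy
    is exactly v and xi(D) = 1; and theta = (1 - b) / 4 makes beta(D) = b.  Along
    the segment (1 - t) L_b + t D of copulas beta is constant and xi is a quadratic
    polynomial in t from |b|^3 / 2 to 1 ([xi_mixture]), so the intermediate value
    theorem fills the region; its end points t = 0 and t = 1 also give the values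
    of xi at L_b and D. *)

(** * Integrals of functions that need not be measurable *)

Section LowerIntegral.
Context d (T : measurableType d) (R : realType) (mu : {measure set T -> \bar R}).
Import HBNNSimple.
Local Open Scope ereal_scope.

(** The integral of a nonnegative function is a supremum over the simple functions
    below it, which makes it monotone without measurability.  This is what bounds
    the integrals defining xi, whose integrands, the squared derivative in u and
    the resulting function of v, come without a proof of measurability. *)
Lemma ae_ge0_le_integral_nonmeasurable (D : set T) (f g : T -> \bar R) :
  (forall x, D x -> 0 <= f x) -> (forall x, D x -> 0 <= g x) ->
  {ae mu, forall x, D x -> f x <= g x} ->
  \int[mu]_(x in D) f x <= \int[mu]_(x in D) g x.
Proof.
move=> f0 g0 [N [mN N0 subN]].
rewrite ge0_integralE// [leRHS]ge0_integralE//.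
apply: ge_ereal_sup => _ [h hf <-].
(* The simple function h, set to 0 on the exceptional null set N, is below g
   everywhere and has the same integral as h. *)
have mNC : measurable (~` N) by exact: measurableC.
apply: le_ereal_sup_tmp; exists (sintegral mu (proj_nnsfun h mNC)).
  exists (proj_nnsfun h mNC) => // x; rewrite /= mindicE.
  have [xN|xN] := boolP (x \in ~` N); rewrite ?mulr1 ?mulr0.
    apply: le_trans (hf x) _; rewrite !patchE; case: ifPn => // xD.
    apply/negP => /negP; rewrite inE in xN; move/negP => fg; apply: xN.
    by apply: subN => /= /(_ (set_mem xD)).
  by rewrite patchE; case: ifPn => // xD; apply: g0; exact: set_mem.
rewrite -!integralT_nnsfun.
rewrite le_eqVlt; apply/orP; left; apply/eqP.
apply: ge0_ae_eq_integral => //.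
- by apply/measurable_EFinP.
- by apply/measurable_EFinP.
- by move=> x _; rewrite lee_fin.
- by move=> x _; rewrite lee_fin.
exists N; split => // x /= H; apply: contrapT => xN; apply: H => _.
by rewrite mindicE mem_set// mulr1.
Qed.

End LowerIntegral.

Section Lebesgue01.
Context (R : realType).
Notation mu := (@lebesgue_measure R).
Implicit Types (f g h : R -> R).

Lemma ae_imply (P Q : R -> Prop) : (forall x, P x -> Q x) ->
  {ae mu, forall x, P x} -> {ae mu, forall x, Q x}.
Proof. by move=> PQ; apply: filterS => //; exact: (ae_filter_ringOfSetsType mu). Qed.

Lemma ae_imply2 (P Q S : R -> Prop) : (forall x, P x -> Q x -> S x) ->
  {ae mu, forall x, P x} -> {ae mu, forall x, Q x} -> {ae mu, forall x, S x}.
Proof.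
by move=> PQS; apply: filterS2 => //; exact: (ae_filter_ringOfSetsType mu).
Qed.

Lemma ae_neq (a : R) : {ae mu, forall x, x != a}.
Proof.
exists [set a]; split => //; first exact: lebesgue_measure_set1.
by move=> x /= /negP; rewrite negbK => /eqP.
Qed.

Lemma ae_oo_cc01 (P : R -> Prop) :
  {ae mu, forall x, x \in `]0, 1[ -> P x} ->
  {ae mu, forall x, x \in `[0, 1] -> P x}.
Proof.
move=> aeP; apply: ae_imply2 (ae_neq 0) (ae_imply2 (fun x => @conj _ _) (ae_neq 1) aeP).
move=> x x0 [x1 Px]; rewrite in_itv/= !le_eqVlt => /andP[].
rewrite eq_sym (negbTE x0) (negbTE x1) /= => x0' x1'.
by apply: Px; rewrite in_itv/= x0' x1'.
Qed.

(** Finiteness of the larger integral cannot be dropped: the real-valued integral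
    of a function with infinite integral is 0. *)
Lemma ae_ge0_le_Rintegral (D : set R) f g :
  (forall x, D x -> 0 <= f x) -> (forall x, D x -> 0 <= g x) ->
  {ae mu, forall x, D x -> f x <= g x} ->
  (\int[mu]_(x in D) (g x)%:E < +oo)%E ->
  \int[mu]_(x in D) f x <= \int[mu]_(x in D) g x.
Proof.
move=> f0 g0 fg ig.
have le : (\int[mu]_(x in D) (f x)%:E <= \int[mu]_(x in D) (g x)%:E)%E.
  by apply: ae_ge0_le_integral_nonmeasurable.
have f0' : (0 <= \int[mu]_(x in D) (f x)%:E)%E by apply: integral_ge0.
have g0' : (0 <= \int[mu]_(x in D) (g x)%:E)%E by apply: integral_ge0.
by rewrite /Rintegral fine_le// ge0_fin_numE// (le_lt_trans le).
Qed.

Lemma ae_eq_Rintegral (D : set R) f g : measurable D -> measurable_fun D g ->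
  (forall x, D x -> 0 <= f x) -> {ae mu, forall x, D x -> f x = g x} ->
  \int[mu]_(x in D) f x = \int[mu]_(x in D) g x.
Proof.
move=> mD mg f0 fg; congr fine.
(* The two halves of the proof meet at |g|, which is nonnegative everywhere and
   not only almost everywhere. *)
transitivity (\int[mu]_(x in D) `|g x|%:E)%E.
  apply/eqP; rewrite eq_le.
  apply/andP; split; apply: ae_ge0_le_integral_nonmeasurable => //.
    by apply: ae_imply fg => x /[apply] ->; rewrite lee_fin ler_norm.
  apply: ae_imply fg => x fgx Dx; rewrite -(fgx Dx) lee_fin ger0_norm//; exact: f0.
apply: ae_eq_integral => //.
- by apply/measurable_EFinP; exact: measurableT_comp.
- exact/measurable_EFinP.
- apply: ae_imply fg => x fgx Dx.
  by rewrite -(fgx Dx) ger0_norm//; exact: f0.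
Qed.

End Lebesgue01.

(** * Functions with slopes in [0,1] are integrals of their derivatives *)

Section Density.
Context (R : realType).
Notation mu := (@lebesgue_measure R).

Definition slope01 (h : R -> R) :=
  {in `[0, 1] &, forall x y, x <= y -> 0 <= h y - h x <= y - x}.

(** Precomposing with this retraction onto [0,1] extends functions given on [0,1]
    to the whole line while keeping their slopes in [0,1]. *)
Definition clamp01 (x : R) : R := Num.max 0 (Num.min 1 x).

Lemma clamp01_in x : clamp01 x \in `[0, 1].
Proof. by rewrite in_itv /= /clamp01 le_max ge_max lexx ler01 ge_min lexx. Qed.

Lemma clamp01_id x : x \in `[0, 1] -> clamp01 x = x.
Proof. by rewrite in_itv /= => /andP[x0 x1]; rewrite /clamp01 min_r// max_r. Qed.

Lemma le_clamp01 x y : x <= y -> 0 <= clamp01 y - clamp01 x <= y - x.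
Proof.
rewrite /clamp01 /Num.max /Num.min => xy.
by case: (ltP 1 x) => ?; case: (ltP 1 y) => ?; case: ltP => ?; case: ltP => ?; lra.
Qed.

Lemma lipschitz_continuous (f : R -> R) (M : R) :
  (forall x y, `|f x - f y| <= M * `|x - y|) -> continuous f.
Proof.
move=> fM x; apply/(@cvgrPdist_lt _ R^o) => e e0.
have M0 : 0 < `|M| + 1 by rewrite ltr_wpDl.
near=> y; apply: le_lt_trans (fM x y) _.
have : `|x - y| < e / (`|M| + 1).
  by near: y; apply: cvgr_dist_lt => //; rewrite divr_gt0.
rewrite ltr_pdivlMr// => xy; apply: le_lt_trans xy; rewrite mulrC ler_wpM2l//.
by rewrite (le_trans (ler_norm _))// lerDl.
Unshelve. all: by end_near. Qed.

Lemma slope01_continuous (h : R -> R) :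
  (forall x y, x <= y -> 0 <= h y - h x <= y - x) -> continuous h.
Proof.
move=> hL; apply: (@lipschitz_continuous _ 1) => x y; rewrite mul1r.
by case: (leP x y) => [/hL|/ltW/hL] /andP[h0 h1];
  [rewrite distrC [leRHS]distrC|]; rewrite !ger0_norm// (le_trans h0).
Qed.

(** The constant [al] lets one branch of a piecewise affine function be treated at a
    time; [h] is any function whose derivative is already known at [x]. *)
Lemma derivable_near_affineD (k h : R -> R) (x al s t : R) :
  (\forall y \near x, al + s * y + t * h y = k y) -> derivable h x 1 ->
  derivable k x 1 /\ derive1 k x = s + t * derive1 h x.
Proof.
move=> kE dh.
pose p : {poly R} := al%:P + s *: 'X.
have pE : horner p + (t *: h) = (fun y => al + s * y + t * h y).
  by apply/funext => y; rewrite !fctE !(hornerD, hornerC, hornerZ, hornerX).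
have p' : p^`().[x] = s.
  by rewrite !(derivD, derivC, derivZ, derivX) add0r hornerZ hornerC mulr1.
have dk : is_derive x 1 k (s + t * derive1 h x).
  apply: near_eq_is_derive kE _; rewrite -pE -p' derive1E.
  exact: is_deriveD (is_derive_poly p x) (is_deriveZ _ (derivableP dh)).
by split; [exact: ex_derive|rewrite derive1E; exact: derive_val].
Qed.

Lemma derive1_near_affine (k : R -> R) (x al s : R) :
  (\forall y \near x, al + s * y = k y) -> derive1 k x = s.
Proof.
move=> kE; have [|_ ->] := @derivable_near_affineD k id x al s 0 _
  (@derivable_id _ _ _ _).
  by apply: filterS kE => y <-; rewrite mul0r addr0.
by rewrite mul0r addr0.
Qed.

Lemma derive1_slope01 (h : R -> R) x :
  (forall x y, x <= y -> 0 <= h y - h x <= y - x) ->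
  derivable h x 1 -> 0 <= derive1 h x <= 1.
Proof.
move=> hL dh; rewrite derive1E.
have q01 : \forall t \near 0^', 0 <= t^-1 *: (h (t *: 1 + x) - h x) <= 1.
  near=> t.
  have t0 : t != 0 by near: t; exact: nbhs_dnbhs_neq.
  have -> : t *: 1 = t by rewrite /GRing.scale /= mulr1.
  have -> : t^-1 *: (h (t + x) - h x) = (h (t + x) - h x) / t by rewrite mulrC.
  move: t0; rewrite neq_lt => /orP[t0|t0].
    have := hL (t + x) x; rewrite gerDr => /(_ (ltW t0)) H.
    by rewrite ler_ndivlMr// ler_ndivrMr//; lra.
  have := hL x (t + x); rewrite lerDr => /(_ (ltW t0)) H.
  by rewrite ler_pdivlMr// ler_pdivrMr//; lra.
apply/andP; split.
- by apply: limr_ge => //; apply: filterS q01 => t /andP[].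
- by apply: limr_le => //; apply: filterS q01 => t /andP[].
Unshelve. all: by end_near. Qed.

Lemma lebesgue_stieltjes_measure_oc (f : cumulative R R) a b : a <= b ->
  lebesgue_stieltjes_measure f `]a, b]%classic = (f b - f a)%:E.
Proof.
move=> ab; rewrite /lebesgue_stieltjes_measure /measure_extension /=.
by rewrite measurable_mu_extE/= ?wlength_itv_bnd//; exact: is_ocitv.
Qed.

Variable h : R -> R.
Hypothesis hL : slope01 h.

(* The Stieltjes measures of h1 and of h2 = id - h1 add up to Lebesgue measure, so
   each of them is dominated by it. *)
Let h1 x := h (clamp01 x).
Let h2 x := x - h1 x.

Let h1L x y : x <= y -> 0 <= h1 y - h1 x <= y - x.
Proof.
move=> xy; have /andP[c0 c1] := le_clamp01 xy.
have := hL (clamp01_in x) (clamp01_in y).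
rewrite -subr_ge0 => /(_ c0)/andP[-> le1].
exact: le_trans c1.
Qed.

Let h2L x y : x <= y -> 0 <= h2 y - h2 x <= y - x.
Proof. by rewrite /h2 => /h1L; lra. Qed.

Let nd1 : nondecreasing h1.
Proof. by move=> x y /h1L /andP[]; rewrite subr_ge0. Qed.
Let nd2 : nondecreasing h2.
Proof. by move=> x y /h2L /andP[]; rewrite subr_ge0. Qed.
Let rc1 : right_continuous h1.
Proof. by apply/right_continuousW; exact: slope01_continuous. Qed.
Let rc2 : right_continuous h2.
Proof. by apply/right_continuousW; exact: slope01_continuous. Qed.
#[local] HB.instance Definition _ := isCumulative.Build R _ R h1 nd1 rc1.
#[local] HB.instance Definition _ := isCumulative.Build R _ R h2 nd2 rc2.

Let nu1 : {measure set (measurableTypeR R) -> \bar R} :=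
  lebesgue_stieltjes_measure h1.
Let nu2 : {measure set (measurableTypeR R) -> \bar R} :=
  lebesgue_stieltjes_measure h2.

Let nu1_itv a b : a <= b -> nu1 `]a, b]%classic = (h1 b - h1 a)%:E.
Proof. exact: lebesgue_stieltjes_measure_oc. Qed.
Let nu2_itv a b : a <= b -> nu2 `]a, b]%classic = (h2 b - h2 a)%:E.
Proof. exact: lebesgue_stieltjes_measure_oc. Qed.

Let nu_le A : measurable A -> (nu1 A <= mu A)%E.
Proof.
move=> mA.
have -> : mu A = measure_add nu1 nu2 A.
  apply: lebesgue_measure_unique => // _ [[a b] _ <-] /=.
  have [ab|ba] := leP a b; last first.
    by rewrite set_itv_ge ?measure0// bnd_simp -leNgt ltW.
  transitivity ((h1 b - h1 a)%:E + (h2 b - h2 a)%:E)%E; last first.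
    rewrite -(nu1_itv ab) -(nu2_itv ab).
    exact/esym/(measure_addE nu1 nu2).
  rewrite lebesgue_measure_itv /= lte_fin.
  move: ab; rewrite le_eqVlt => /predU1P[->|ab].
    by rewrite ltxx !subrr adde0.
  by rewrite ab -!EFinD; congr (_%:E); rewrite /h2; ring.
by rewrite measure_addE leeDl.
Qed.

(* Restricting to [0,1] makes the measure finite, as the Radon-Nikodym theorem
   for charges requires. *)
Let I01 : set (measurableTypeR R) := `[0, 1]%classic.
Let m01 : measurable I01.
Proof. exact: measurable_itv. Qed.

Let mu01 : mu I01 = 1%:E.
Proof. by rewrite lebesgue_measure_itv /= lte_fin ltr01 oppr0 adde0. Qed.

Let nu01 : (nu1 I01 < +oo)%E.
Proof. by apply: le_lt_trans (nu_le m01) _; rewrite mu01 ltry. Qed.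

Let nu : {finite_measure set (measurableTypeR R) -> \bar R} := mfrestr m01 nu01.

Let nu_mu : nu `<< mu.
Proof.
apply/null_content_dominatesP => A mA A0; apply/eqP.
rewrite eq_le measure_ge0 andbT -A0.
apply: le_trans (nu_le mA); change (nu1 (A `&` I01) <= nu1 A)%E.
by rewrite le_measure// inE//; exact: measurableI.
Qed.

Let nu_mu' : charge_of_finite_measure nu `<< mu.
Proof. exact: nu_mu. Qed.

Let rn : R -> \bar R := Radon_Nikodym (charge_of_finite_measure nu) mu.
Let f x := fine (rn x).

Let rnE : rn = EFin \o f.
Proof.
by apply/funext => x; rewrite /f /= fineK//; exact: Radon_Nikodym_fin_num.
Qed.

Let fint : mu.-integrable setT (EFin \o f).
Proof. by rewrite -rnE; exact: Radon_Nikodym_integrable. Qed.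

Let intf A : measurable A ->
  \int[mu]_(x in A) f x = fine (nu1 (A `&` `[0, 1])).
Proof.
move=> mA; congr fine.
transitivity (\int[mu]_(x in A) rn x)%E; first by rewrite rnE.
exact/esym/(Radon_Nikodym_integral nu_mu' mA).
Qed.

Let nu_itv0 a b : 0 <= a -> a <= b -> b <= 1 ->
  nu1 `[a, b]%classic = (h b - h a)%:E.
Proof.
move=> a0 ab b1.
have -> : nu1 `[a, b]%classic = nu1 `]a, b]%classic.
  rewrite -(setU1itv false)// measureU//; last first.
    by apply/seteqP; split => // x /= [->]; rewrite in_itv/= ltxx.
  suff a0' : nu1 [set a] = 0%E by rewrite -[RHS]add0e; congr (_ + _)%E.
  apply/eqP; rewrite eq_le measure_ge0 andbT.
  by apply: le_trans (nu_le (measurable_set1 a)) _; rewrite lebesgue_measure_set1.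
by rewrite nu1_itv// /h1 !clamp01_id// in_itv/=; apply/andP; split; lra.
Qed.

Let F x := \int[mu]_(t in `]-oo, x]) f t.

Let FE x : x \in `]0, 1[ -> F x = h x - h 0.
Proof.
rewrite in_itv/= => /andP[x0 x1]; rewrite /F intf//.
have -> : `]-oo, x] `&` `[0, 1] = `[0, x]%classic :> set R.
  apply/seteqP; split => y /=; rewrite !in_itv/=.
    by move=> [-> /andP[->]].
  by move=> /andP[-> yx]; rewrite yx (le_trans yx)// ltW.
by rewrite nu_itv0// ltW.
Qed.

Let derivable_h k x : {in `]0, 1[, k =1 h} -> x \in `]0, 1[ ->
  derivable F x 1 -> derivable k x 1 /\ derive1 k x = derive1 F x.
Proof.
move=> kh x01 dF.
have [|dk ->] := @derivable_near_affineD k F x (h 0) 0 1 _ dF.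
  near=> y; have y01 : y \in `]0, 1[ by near: y; exact: near_in_itvoo.
  by rewrite FE// kh//; ring.
by split=> //; ring.
Unshelve. all: by end_near. Qed.

(** A function with slopes in [0,1] is differentiable almost everywhere and is the
    integral of its derivative: Radon-Nikodym provides a density of its Stieltjes
    measure, and Lebesgue differentiation identifies that density with the
    derivative.  The bounds on [phi] can be required everywhere, by clamping. *)
Lemma slope01_density : exists phi : R -> R,
  [/\ measurable_fun setT phi, forall x, 0 <= phi x <= 1,
      {ae mu, forall x, x \in `]0, 1[ ->
         derivable h x 1 /\ derive1 h x = phi x} &
      {in `[0, 1] &, forall a b, a <= b ->
         \int[mu]_(x in `[a, b]) phi x = h b - h a}].
Proof.
have mf : measurable_fun setT f.
  by apply/measurable_EFinP; exact: measurable_int fint.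
have aeF : {ae mu, forall x, derivable F x 1 /\ derive1 F x = f x}.
  apply: FTC1Ny => [y|]; first exact: integrableS fint.
  by apply: open_integrable_locally => //; exact: openT.
have aef : {ae mu, forall x, x \in `]0, 1[ ->
    [/\ derivable h x 1, derive1 h x = clamp01 (f x) & clamp01 (f x) = f x]}.
  apply: ae_imply aeF => x [dF F'] x01.
  have [dh h'] := derivable_h (fun _ _ => erefl) x01 dF.
  have h1h : {in `]0, 1[, h1 =1 h}.
    by move=> y y01; rewrite /h1 clamp01_id//; exact: subset_itv_oo_cc.
  (* h1 has its slopes in [0,1] on the whole line, which bounds its derivative. *)
  have [dh1 h1'] := derivable_h h1h x01 dF.
  suff cf : clamp01 (f x) = f x by split => //; rewrite h' F' cf.
  by rewrite clamp01_id// -F' -h1' in_itv; exact: derive1_slope01.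
have mclamp : measurable_fun setT (clamp01 \o f).
  apply: measurableT_comp => //; apply: continuous_measurable_fun.
  by apply: slope01_continuous => x y; exact: le_clamp01.
exists (clamp01 \o f); split => //.
- by move=> x; have := clamp01_in (f x); rewrite in_itv.
- by apply: ae_imply aef => x /[apply] -[].
- move=> a b a01 b01 ab.
  have [/andP[a0 a1] /andP[b0 b1]] : 0 <= a <= 1 /\ 0 <= b <= 1.
    by move: a01 b01; rewrite !in_itv.
  transitivity (\int[mu]_(x in `[a, b]) f x).
    congr fine; apply: ae_eq_integral => //.
    + by apply: measurable_funTS; exact/measurable_EFinP.
    + by apply: measurable_funTS; exact/measurable_EFinP.
    have aecf : {ae mu, forall x, x \in `]0, 1[ -> clamp01 (f x) = f x}.
      by apply: ae_imply aef => x /[apply] -[].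
    apply: ae_imply (ae_oo_cc01 aecf) => x cf.
    rewrite /= in_itv/= => /andP[ax xb].
    by rewrite cf// in_itv/=; apply/andP; split; lra.
  rewrite intf//.
  have -> : `[a, b] `&` `[0, 1] = `[a, b]%classic :> set R.
    apply/seteqP; split => y /=; rewrite !in_itv/=; first by case.
    by move=> /andP[ay yb]; rewrite ay yb; split => //; lra.
  by rewrite nu_itv0.
Qed.

End Density.

(** * The energy of a function with slopes in [0,1] *)

Section Energy.
Context (R : realType).
Notation mu := (@lebesgue_measure R).
Implicit Types (h k phi : R -> R).

Definition energy h (a b : R) := \int[mu]_(x in `[a, b]) (derive1 h x) ^+ 2.

Lemma bounded_Rintegrable (f : R -> R) (a b M : R) : measurable_fun setT f ->
  (forall x, `|f x| <= M) -> mu.-integrable `[a, b] (EFin \o f).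
Proof.
move=> mf fM; apply: measurable_bounded_integrable => //.
- by apply: compact_finite_measure; exact: segment_compact.
- exact: measurable_funTS.
- exists M; split; first exact: num_real.
  by move=> x Mx y _; apply: le_trans (fM y) (ltW Mx).
Qed.

Lemma Rintegral_cst_itv (a b c : R) : a <= b ->
  \int[mu]_(x in `[a, b]) c = c * (b - a).
Proof.
move=> ab; rewrite Rintegral_cst//; congr (_ * _).
transitivity (fine (mu (`[a, b]%classic : set R))) => //.
rewrite lebesgue_measure_itv/= lte_fin.
by move: ab; rewrite le_eqVlt => /predU1P[->|->//]; rewrite ltxx subrr.
Qed.

Lemma Rintegral_affine phi (a b al be : R) : a <= b ->
  mu.-integrable `[a, b] (EFin \o phi) ->
  \int[mu]_(x in `[a, b]) (al + be * phi x) =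
  al * (b - a) + be * \int[mu]_(x in `[a, b]) phi x.
Proof.
move=> ab ip; rewrite RintegralD//.
- by rewrite Rintegral_cst_itv// RintegralZl.
- by apply: (@bounded_Rintegrable (cst al) _ _ `|al|).
- by apply: eq_integrable (integrableZl _ be ip).
Qed.

Lemma Rintegral_split (f : R -> R) (a m b : R) : a <= m -> m <= b ->
  mu.-integrable `[a, b] (EFin \o f) ->
  \int[mu]_(x in `[a, b]) f x =
  \int[mu]_(x in `[a, m]) f x + \int[mu]_(x in `[m, b]) f x.
Proof.
move=> am mb fi; have := @Rintegral_itvB R f (BLeft a) (BRight b) m fi.
rewrite !bnd_simp => /(_ am mb).
rewrite Rintegral_itv_obnd_cbnd; first by move=> <-; rewrite addrC subrK.
by apply: integrableS fi => //; apply: subset_itv; rewrite bnd_simp.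
Qed.

Section density_consequences.
Variable h : R -> R.
Hypothesis hL : slope01 h.

Lemma energy_density : exists phi,
  [/\ measurable_fun setT phi, forall x, 0 <= phi x <= 1,
      {ae mu, forall x, x \in `]0, 1[ ->
         derivable h x 1 /\ derive1 h x = phi x},
      {in `[0, 1] &, forall a b, a <= b ->
         \int[mu]_(x in `[a, b]) phi x = h b - h a} &
      {in `[0, 1] &, forall a b,
         energy h a b = \int[mu]_(x in `[a, b]) phi x ^+ 2}].
Proof.
have [phi [mphi phi01 aephi iphi]] := slope01_density hL.
exists phi; split => // a b; rewrite !in_itv /= => /andP[a0 a1] /andP[b0 b1].
apply: ae_eq_Rintegral => //.
- by apply: measurable_funTS; exact: measurable_funX.
- by move=> x _; exact: sqr_ge0.
have : {ae mu, forall x, x \in `]0, 1[ -> derive1 h x = phi x}.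
  by apply: ae_imply aephi => x /[apply] -[].
move=> /ae_oo_cc01; apply: ae_imply => x hx; rewrite /= in_itv/= => /andP[ax xb].
by rewrite hx// in_itv/=; apply/andP; split; lra.
Qed.

Let norm_le1 phi : (forall x, 0 <= phi x <= 1) -> forall x, `|phi x| <= 1.
Proof. by move=> p01 x; have /andP[p0 p1] := p01 x; rewrite ger0_norm. Qed.

Let sqr_le1 phi : (forall x, 0 <= phi x <= 1) -> forall x, `|phi x ^+ 2| <= 1.
Proof.
move=> p01 x; have /andP[p0 p1] := p01 x.
by rewrite ger0_norm ?sqr_ge0// expr_le1.
Qed.

(** The square lies above its tangent at [c]; taking [c] to be the mean slope gives
    the Cauchy-Schwarz bound. *)
Lemma energy_tangent (a b c : R) : a \in `[0, 1] -> b \in `[0, 1] -> a <= b ->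
  2 * c * (h b - h a) - c ^+ 2 * (b - a) <= energy h a b.
Proof.
move=> a01 b01 ab; have [phi [mphi phi01 _ iphi ->//]] := energy_density.
rewrite -iphi// [leLHS]addrC -mulNr.
have ip : mu.-integrable `[a, b] (EFin \o phi).
  exact: bounded_Rintegrable mphi (norm_le1 phi01).
rewrite -Rintegral_affine//; apply: le_Rintegral => //.
- apply: (@bounded_Rintegrable _ _ _ (c ^+ 2 + `|2 * c|)).
    by apply: measurable_funD => //; exact: measurable_funM.
  move=> x; apply: le_trans (ler_normD _ _) _.
  rewrite normrN normrX real_normK ?num_real// lerD2l normrM.
  by rewrite ler_piMr// norm_le1.
- apply: (@bounded_Rintegrable (fun x => phi x ^+ 2) _ _ 1).
    exact: measurable_funX.
  exact: sqr_le1.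
- move=> x _; have := sqr_ge0 (phi x - c); lra.
Qed.

Lemma energy_le (a b : R) : a \in `[0, 1] -> b \in `[0, 1] -> a <= b ->
  energy h a b <= h b - h a.
Proof.
move=> a01 b01 ab; have [phi [mphi phi01 _ iphi ->//]] := energy_density.
rewrite -iphi//; apply: le_Rintegral => //.
- apply: (@bounded_Rintegrable (fun x => phi x ^+ 2) _ _ 1).
    exact: measurable_funX.
  exact: sqr_le1.
- exact: bounded_Rintegrable mphi (norm_le1 phi01).
- move=> x _; have /andP[p0 p1] := phi01 x.
  by rewrite expr2 ler_piMr.
Qed.

Lemma energy_split (a m b : R) :
  a \in `[0, 1] -> m \in `[0, 1] -> b \in `[0, 1] ->
  a <= m -> m <= b -> energy h a b = energy h a m + energy h m b.
Proof.
move=> a01 m01 b01 am mb; have [phi [mphi phi01 _ iphi E]] := energy_density.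
rewrite !E//; apply: Rintegral_split => //.
apply: (@bounded_Rintegrable (fun x => phi x ^+ 2) _ _ 1).
  exact: measurable_funX.
exact: sqr_le1.
Qed.

(** Besides the mean slope, the energy controls how far the graph is from its chord
    at an interior point: this is what forces a minimizer to be affine. *)
Lemma energy_refined (a m b : R) :
  a \in `[0, 1] -> m \in `[0, 1] -> b \in `[0, 1] ->
  a <= m -> m <= b -> a < b ->
  ((h b - h a) ^+ 2 + 4 * (h m - h a - (h b - h a) / (b - a) * (m - a)) ^+ 2)
    / (b - a) <= energy h a b.
Proof.
move=> a01 m01 b01 am mb ab; set s := (h b - h a) / (b - a).
rewrite (energy_split a01 m01 b01 am mb).
(* With w the signed height of the graph above its chord at m, the tangents at
   s + k on [a, m] and at s - k on [m, b] give together
   s^2 (b - a) + 4 k w - k^2 (b - a), which is largest at this k. *)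
set w := h m - h a - s * (m - a); set k := 2 * w / (b - a).
have := energy_tangent (s + k) a01 m01 am.
have := energy_tangent (s - k) m01 b01 mb.
have -> : h m - h a = w + s * (m - a) by rewrite /w; ring.
have -> : h b - h m = s * (b - m) - w.
  by rewrite /w /s; field; lra.
have -> : h b - h a = s * (b - a) by rewrite /s; field; lra.
have -> : ((s * (b - a)) ^+ 2 + 4 * w ^+ 2) / (b - a) =
    s ^+ 2 * (b - a) + 4 * k * w - k ^+ 2 * (b - a).
  by rewrite /k; field; lra.
lra.
Qed.

(** An exact value for the energy of [k] when the square of its derivative is an
    affine function of the derivative of [h], whose integral is known. *)
Lemma energy_affine k (a b al be : R) : a \in `[0, 1] -> b \in `[0, 1] -> a <= b ->
  {ae mu, forall x, x \in `]0, 1[ -> x \in `[a, b] -> derivable h x 1 ->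
     derive1 k x ^+ 2 = al + be * derive1 h x} ->
  energy k a b = al * (b - a) + be * (h b - h a).
Proof.
move=> a01 b01 ab kh; have [phi [mphi phi01 aephi iphi E]] := energy_density.
rewrite -iphi// -Rintegral_affine//; last first.
  exact: bounded_Rintegrable mphi (norm_le1 phi01).
apply: ae_eq_Rintegral => //.
- by apply: measurable_funTS; apply: measurable_funD => //; exact: measurable_funM.
- by move=> x _; exact: sqr_ge0.
have : {ae mu, forall x, x \in `]0, 1[ -> x \in `[a, b] ->
    derive1 k x ^+ 2 = al + be * phi x}.
  apply: ae_imply2 kh aephi => x kx px x01 xab.
  by have [dh <-] := px x01; exact: kx.
move=> /ae_oo_cc01; apply: ae_imply => x kx xab; apply: kx => //.
move: xab a01 b01; rewrite /= !in_itv/=; lra.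
Qed.

End density_consequences.
End Energy.

(** * Integrals of continuous functions on segments *)

Section IntegralsOnSegments.
Context (R : realType).
Notation mu := (@lebesgue_measure R).
Implicit Types (f g : R -> R).

Lemma continuous_integrable f a b :
  continuous f -> mu.-integrable `[a, b] (EFin \o f).
Proof.
move=> cf; apply: continuous_compact_integrable; first exact: segment_compact.
exact: continuous_subspaceT.
Qed.

Lemma Rintegral_horner (p : {poly R}) (a b : R) : a <= b ->
  \int[mu]_(x in `[a, b]) p^`().[x] = p.[b] - p.[a].
Proof.
rewrite le_eqVlt => /predU1P[->|ab]; first by rewrite set_itv1 Rintegral_set1 subrr.
rewrite /Rintegral (@continuous_FTC2 _ _ (fun x => p.[x])) //.
- by apply: continuous_subspaceT => x; exact: continuous_horner.
- split; first by move=> x _; exact: derivable_horner.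
  + by apply: cvg_at_right_filter; exact: continuous_horner.
  + by apply: cvg_at_left_filter; exact: continuous_horner.
- by move=> x _; rewrite -derivE.
Qed.

Lemma Rintegral_quadratic (al be ga a b : R) : a <= b ->
  \int[mu]_(x in `[a, b]) (al + be * x + ga * x ^+ 2) =
  al * (b - a) + be * (b ^+ 2 - a ^+ 2) / 2 + ga * (b ^+ 3 - a ^+ 3) / 3.
Proof.
move=> ab; pose p : {poly R} := al *: 'X + (be / 2) *: 'X^2 + (ga / 3) *: 'X^3.
transitivity (p.[b] - p.[a]); last first.
  by rewrite /p !(hornerD, hornerZ, hornerXn, hornerX); field.
rewrite -Rintegral_horner//; apply: eq_Rintegral => x _.
by rewrite /p !(derivD, derivZ, derivXn, derivX, hornerD, hornerZ, hornerMn,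
  hornerXn, hornerX, hornerC) /=; field.
Qed.

Lemma continuous_ge0_Rintegral_eq0 f : continuous f -> (forall x, 0 <= f x) ->
  \int[mu]_(x in `[0, 1]) f x <= 0 -> {in `[0, 1], forall x, f x = 0}.
Proof.
move=> cf f0 If0 x; rewrite in_itv/= => /andP[x0 x1].
apply/eqP; rewrite eq_le f0 andbT leNgt; apply/negP => fx.
have : \forall y \near x, f x / 2 < f y.
  by apply: cvgr_gt (cf x) _ _; rewrite ltr_pdivrMr// mulr_natr mulr2n ltrDl.
move=> /nbhs_ballP[e /= e0 He].
pose p := Num.max 0 (x - e / 2); pose q := Num.min 1 (x + e / 2).
have [p0 pe px] : [/\ 0 <= p, x - e / 2 <= p & p <= x].
  by rewrite /p; case: (leP 0 (x - e / 2)) => ?; split; lra.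
have [q1 qe xq] : [/\ q <= 1, q <= x + e / 2 & x <= q].
  by rewrite /q; case: (leP 1 (x + e / 2)) => ?; split; lra.
have pq : p < q.
  rewrite /p /q.
  by case: (leP 0 (x - e / 2)) => ?; case: (leP 1 (x + e / 2)) => ?; lra.
have fi a b : mu.-integrable `[a, b] (EFin \o f) by exact: continuous_integrable.
suff : 0 < \int[mu]_(x in `[0, 1]) f x by rewrite ltNge If0.
have pos a b : 0 <= \int[mu]_(x in `[a, b]) f x by exact: Rintegral_ge0.
rewrite (@Rintegral_split _ _ _ p)//; last by lra.
rewrite (@Rintegral_split _ _ p q)//; last by lra.
rewrite ltr_wpDl// ltr_pwDl//; last first.
apply: (@lt_le_trans _ _ (f x / 2 * (q - p))).
  by rewrite mulr_gt0 ?divr_gt0// subr_gt0.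
rewrite -Rintegral_cst_itv; last exact: ltW.
apply: le_Rintegral => //.
  by apply: continuous_integrable => y; exact: cvg_cst.
move=> y; rewrite /= in_itv/= => /andP[py yq].
apply/ltW/He; rewrite /ball/= ltr_norml; apply/andP; split; lra.
Qed.

End IntegralsOnSegments.

(** * Copulas and the average energy of their sections *)

Section Copulas.
Context (R : realType).
Notation mu := (@lebesgue_measure R).
Implicit Types (C : R -> R -> R).

Lemma in01 (x : R) : (x \in `[0, 1]) = (0 <= x <= 1).
Proof. by rewrite in_itv. Qed.

Lemma in01_0 : (0 : R) \in `[0, 1]. Proof. by rewrite in01 lexx ler01. Qed.
Lemma in01_1 : (1 : R) \in `[0, 1]. Proof. by rewrite in01 lexx ler01. Qed.
Lemma in01_half : (2^-1 : R) \in `[0, 1]. Proof. by rewrite in01; lra. Qed.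
Hint Resolve in01_0 in01_1 in01_half : core.

Lemma copula_slope01l C v : copula C -> v \in `[0, 1] -> slope01 (C ^~ v).
Proof.
move=> [_ Cu Cv C2] v01 x y x01 y01 xy.
have /andP[v0 v1] : 0 <= v <= 1 by rewrite -in01.
(* Monotonicity comes from the rectangle below v, the Lipschitz bound from the
   rectangle above it. *)
have := C2 _ _ x01 y01 _ _ in01_0 v01 xy v0.
have := C2 _ _ x01 y01 _ _ v01 in01_1 xy v1.
have [-> ->] := Cu _ x01; have [-> ->] := Cu _ y01; lra.
Qed.

Lemma copula_slope01r C u : copula C -> u \in `[0, 1] -> slope01 (C u).
Proof.
move=> [_ Cu Cv C2] u01 x y x01 y01 xy.
have /andP[u0 u1] : 0 <= u <= 1 by rewrite -in01.
have := C2 _ _ in01_0 u01 _ _ x01 y01 u0 xy.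
have := C2 _ _ u01 in01_1 _ _ x01 y01 u1 xy.
have [-> ->] := Cv _ x01; have [-> ->] := Cv _ y01; lra.
Qed.

Lemma copula_continuous_clamp C u : copula C -> u \in `[0, 1] ->
  continuous (fun v => C u (clamp01 v)).
Proof.
move=> copC u01; apply: slope01_continuous => x y xy.
have /andP[c0 c1] := le_clamp01 xy.
have := copula_slope01r copC u01 (clamp01_in x) (clamp01_in y).
by rewrite -subr_ge0 => /(_ c0) /andP[-> le1]; exact: le_trans c1.
Qed.

Lemma continuous_clamp01 : continuous (@clamp01 R).
Proof. by apply: slope01_continuous => x y; exact: le_clamp01. Qed.

Lemma copula_2increasing C :
  {in `[0, 1], forall u, C u 0 = 0 /\ C u 1 = u} ->
  {in `[0, 1], forall v, C 0 v = 0 /\ C 1 v = v} ->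
  (forall u1 v1 u2 v2, 0 <= u1 -> u1 <= v1 -> v1 <= 1 ->
     0 <= u2 -> u2 <= v2 -> v2 <= 1 ->
     0 <= C v1 v2 - C u1 v2 - C v1 u2 + C u1 u2) -> copula C.
Proof.
move=> Cu Cv C2; split => // [u v|u1 v1 u01 v01 u2 v2]; last first.
  rewrite !in01 => /andP[? ?] /andP[? ?] ? ?.
  by move: u01 v01; rewrite !in01 => /andP[? ?] /andP[? ?]; exact: C2.
move=> u01 v01.
have [C0v _] := Cv _ v01; have [Cu0 Cu1] := Cu _ u01.
have [C00 _] := Cv _ in01_0; have [C01 _] := Cv _ in01_1.
move: u01 v01; rewrite !in01 => /andP[u0 u1] /andP[v0 v1].
have := C2 0 u 0 v (lexx 0) u0 u1 (lexx 0) v0 v1.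
have := C2 0 u v 1 (lexx 0) u0 u1 v0 v1 (lexx 1).
rewrite C0v C01 C00 Cu0 Cu1; lra.
Qed.

Lemma copula_convex C D t : 0 <= t <= 1 -> copula C -> copula D ->
  copula (fun u v => (1 - t) * C u v + t * D u v).
Proof.
move=> /andP[t0 t1] [C01 Cu Cv C2] [D01 Du Dv D2].
apply: copula_2increasing => [u u01|v v01|u1 v1 u2 v2 ? ? ? ? ? ?].
- by have [-> ->] := Cu _ u01; have [-> ->] := Du _ u01; split; ring.
- by have [-> ->] := Cv _ v01; have [-> ->] := Dv _ v01; split; ring.
have [? ? ? ?] : [/\ u1 \in `[0, 1], v1 \in `[0, 1],
    u2 \in `[0, 1] & v2 \in `[0, 1] ].
  by rewrite !in01; split; apply/andP; split; lra.
have c0 : 0 <= C v1 v2 - C u1 v2 - C v1 u2 + C u1 u2 by exact: C2.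
have d0 : 0 <= D v1 v2 - D u1 v2 - D v1 u2 + D u1 u2 by exact: D2.
rewrite [leRHS](_ : _ = (1 - t) * (C v1 v2 - C u1 v2 - C v1 u2 + C u1 u2) +
  t * (D v1 v2 - D u1 v2 - D v1 u2 + D u1 u2)); last by ring.
by rewrite addr_ge0// mulr_ge0// subr_ge0.
Qed.

Lemma xiE C : chatterjee_xi C = 6 * \int[mu]_(v in `[0, 1]) energy (C ^~ v) 0 1 - 2.
Proof. by []. Qed.

Section energy_integral.
Variable C : R -> R -> R.
Hypothesis copC : copula C.

Lemma energy_le_v v : v \in `[0, 1] -> energy (C ^~ v) 0 1 <= v.
Proof.
move=> v01; have [_ _ Cv _] := copC; have [C0 C1] := Cv _ v01.
have := energy_le (copula_slope01l copC v01) in01_0 in01_1 ler01.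
by rewrite C0 C1 subr0.
Qed.

Lemma energy_ge0 (h : R -> R) a b : 0 <= energy h a b.
Proof. by apply: Rintegral_ge0 => x _; exact: sqr_ge0. Qed.

Let id_lty : (\int[mu]_(v in `[0%R, 1%R]) v%:E < +oo)%E.
Proof.
have : mu.-integrable `[0, 1] (EFin \o @idfun R).
  by apply: continuous_integrable => x; exact: cvg_id.
move=> /integrable_fin_num => /(_ (measurable_itv _)).
by rewrite fin_numE ltey => /andP[].
Qed.

Let energy_lty : (\int[mu]_(v in `[0%R, 1%R]) (energy (C ^~ v) 0 1)%:E < +oo)%E.
Proof.
apply: le_lt_trans id_lty; apply: ae_ge0_le_integral_nonmeasurable.
- by move=> v _; rewrite lee_fin energy_ge0.
- by move=> v; rewrite /= in_itv/= lee_fin => /andP[].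
- by apply: aeW => v v01; rewrite lee_fin; exact: energy_le_v.
Qed.

Lemma le_Rintegral_energy (J : R -> R) :
  (forall v, v \in `[0, 1] -> 0 <= J v <= energy (C ^~ v) 0 1) ->
  \int[mu]_(v in `[0, 1]) J v <= \int[mu]_(v in `[0, 1]) energy (C ^~ v) 0 1.
Proof.
move=> HJ; apply: ae_ge0_le_Rintegral => //.
- by move=> v /HJ /andP[].
- by move=> v _; exact: energy_ge0.
- by apply: aeW => v /HJ /andP[].
Qed.

Lemma Rintegral_energy_le : \int[mu]_(v in `[0, 1]) energy (C ^~ v) 0 1 <= 2^-1.
Proof.
have <- : \int[mu]_(v in `[0, 1]) (0 + 1 * v + 0 * v ^+ 2) = 2^-1 :> R.
  by rewrite Rintegral_quadratic//; field.
under [leRHS]eq_Rintegral do rewrite add0r mul1r mul0r addr0.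
apply: ae_ge0_le_Rintegral => //.
- by move=> v _; exact: energy_ge0.
- by move=> v; rewrite /= in_itv/= => /andP[].
- by apply: aeW => v; exact: energy_le_v.
Qed.

End energy_integral.
End Copulas.
Arguments in01_0 {R}.
Arguments in01_1 {R}.
Arguments in01_half {R}.

(** * The left boundary *)

Section LeftBoundary.
Context (R : realType).
Notation mu := (@lebesgue_measure R).
Hint Resolve in01_0 in01_1 in01_half : core.
Variable b : R.
Hypothesis b1 : -1 <= b <= 1.

Let r := `|b|.
Let r0 : 0 <= r. Proof. exact: normr_ge0. Qed.
Let r1 : r <= 1. Proof. by rewrite /r ler_norml. Qed.

Lemma sqr_g_fun v : g_fun b v ^+ 2 = Num.max (r / 2 - `|v - 2^-1|) 0 ^+ 2.
Proof.
rewrite /g_fun exprMn -/r sqr_sg; have [b0|_] := eqVneq b 0; last by rewrite mul1r.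
rewrite mul0r /r b0 normr0 mul0r sub0r max_r ?expr0n// oppr_le0; exact: normr_ge0.
Qed.

Lemma g_fun_lip v w : `|g_fun b v - g_fun b w| <= 1 * `|v - w|.
Proof.
rewrite mul1r /g_fun -mulrBr normrM.
have : `|Num.sg b| <= 1 by rewrite normr_sg; case: (b != 0).
have : `|Num.max (r / 2 - `|v - 2^-1|) 0 - Num.max (r / 2 - `|w - 2^-1|) 0| <= `|v - w|.
  have := ler_dist_dist (v - 2^-1) (w - 2^-1).
  rewrite (_ : v - 2^-1 - (w - 2^-1) = v - w); last by ring.
  set s := `|v - 2^-1|; set t := `|w - 2^-1|; set m := `|v - w|.
  rewrite !ler_norml => /andP[? ?].
  by case: (leP (r / 2 - s) 0) => ?; case: (leP (r / 2 - t) 0) => ?;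
    apply/andP; split; lra.
move=> le1 le2; rewrite -[leRHS]mul1r; exact: ler_pM.
Qed.

Lemma continuous_g_fun : continuous (g_fun b).
Proof. exact: lipschitz_continuous g_fun_lip. Qed.

Lemma g_fun_eq0 v : r / 2 <= `|v - 2^-1| -> g_fun b v = 0.
Proof. by move=> rv; rewrite /g_fun max_r ?mulr0// subr_le0. Qed.

Lemma g_fun0 : g_fun b 0 = 0.
Proof. by rewrite g_fun_eq0// sub0r normrN ger0_norm; have := r1; lra. Qed.

Lemma g_fun1 : g_fun b 1 = 0.
Proof. by rewrite g_fun_eq0// ger0_norm; have := r1; lra. Qed.

Lemma Rintegral_sqr_g_fun :
  \int[mu]_(v in `[0, 1]) (g_fun b v ^+ 2) = r ^+ 3 / 12.
Proof.
have gi x y : mu.-integrable `[x, y] (EFin \o (fun v => g_fun b v ^+ 2)).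
  by apply: continuous_integrable => v; apply: cvgM; exact: continuous_g_fun.
have piece c d p q : 0 <= p -> p <= q -> q <= 1 ->
    (forall v, p <= v <= q -> g_fun b v ^+ 2 = (c + d * v) ^+ 2) ->
    \int[mu]_(v in `[p, q]) (g_fun b v ^+ 2) =
    c ^+ 2 * (q - p) + c * d * (q ^+ 2 - p ^+ 2) + d ^+ 2 * (q ^+ 3 - p ^+ 3) / 3.
  move=> p0 pq q1 H.
  transitivity (\int[mu]_(v in `[p, q]) (c ^+ 2 + 2 * c * d * v + d ^+ 2 * v ^+ 2)).
    apply: eq_Rintegral => v; rewrite inE/= in_itv/= => /H ->; ring.
  by rewrite Rintegral_quadratic//; field.
(* g_b is affine up to sign on each of the four pieces cut out by p, 1/2 and q. *)
pose p := 2^-1 - r / 2; pose q := 2^-1 + r / 2 : R.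
have := r0; have := r1 => r1' r0'.
rewrite (@Rintegral_split _ _ 0 p)//; [|by rewrite /p; lra..].
rewrite (@Rintegral_split _ _ p 2^-1)//; [|by rewrite /p; lra..].
rewrite (@Rintegral_split _ _ 2^-1 q)//; [|by rewrite /q; lra..].
rewrite (piece 0 0)//; [|by rewrite /p; lra..|]; last first.
  move=> v /andP[_ vp]; rewrite sqr_g_fun max_r ?mul0r ?addr0//.
  by rewrite ler0_norm; move: vp; rewrite /p; lra.
rewrite (piece (- p) 1)//; [|by rewrite /p; lra..|]; last first.
  move=> v /andP[pv v2]; rewrite sqr_g_fun ler0_norm; last by lra.
  by rewrite max_l; [congr (_ ^+ 2); rewrite /p; lra| move: pv; rewrite /p; lra].
rewrite (piece q (-1))//; [|by rewrite /q; lra..|]; last first.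
  move=> v /andP[v2 vq]; rewrite sqr_g_fun ger0_norm; last by lra.
  by rewrite max_l; [congr (_ ^+ 2); rewrite /q; lra| move: vq; rewrite /q; lra].
rewrite (piece 0 0)//; [|by rewrite /q; lra..|]; last first.
  move=> v /andP[qv _]; rewrite sqr_g_fun max_r ?mul0r ?addr0//.
  by rewrite ger0_norm; move: qv; rewrite /q; lra.
by rewrite /p /q; field.
Qed.

Lemma tent_lip (x y : R) : `|tent x - tent y| <= `|x - y|.
Proof.
rewrite /tent.
by case: (lerP x y) => ?; case: (leP x (1 - x)) => ?; case: (leP y (1 - y)) => ?;
  rewrite ler_norml; apply/andP; split; lra.
Qed.

Lemma copula_L : copula (L_copula b).
Proof.
apply: copula_2increasing => [u|v|u1 v1 u2 v2 u10 u1v1 v11 u20 u2v2 v21].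
- rewrite in01 /L_copula => u01; rewrite g_fun0 g_fun1; split; ring.
- rewrite in01 /L_copula /tent subrr subr0 => v01.
  by rewrite min_l// min_r//; split; ring.
rewrite /L_copula.
rewrite [leRHS](_ : _ = (v1 - u1) * (v2 - u2) +
   (tent v1 - tent u1) * (g_fun b v2 - g_fun b u2)); last by ring.
have : `|(tent v1 - tent u1) * (g_fun b v2 - g_fun b u2)| <= (v1 - u1) * (v2 - u2).
  rewrite normrM; apply: ler_pM => //.
    by apply: le_trans (tent_lip _ _) _; rewrite ger0_norm// subr_ge0.
  by apply: le_trans (g_fun_lip _ _) _; rewrite mul1r ger0_norm// subr_ge0.
by rewrite ler_norml => /andP[+ _]; lra.
Qed.

Lemma g_fun_half : g_fun b 2^-1 = b / 2.
Proof.
rewrite /g_fun subrr normr0 subr0 max_l; last by rewrite divr_ge0.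
by rewrite mulrA -numEsg.
Qed.

Lemma beta_L : blomqvist_beta (L_copula b) = b.
Proof.
rewrite /blomqvist_beta /L_copula g_fun_half /tent min_l; last by lra.
by field.
Qed.

Lemma Rintegral_sqrD_g_fun :
  \int[mu]_(v in `[0, 1]) (v ^+ 2 + g_fun b v ^+ 2) = 3^-1 + r ^+ 3 / 12.
Proof.
rewrite RintegralD//.
- rewrite Rintegral_sqr_g_fun; congr (_ + _).
  transitivity (\int[mu]_(v in `[0, 1]) (0 + 0 * v + 1 * v ^+ 2)).
    by apply: eq_Rintegral => v _; ring.
  by rewrite Rintegral_quadratic//; field.
- by apply: continuous_integrable => v; apply: cvgM; exact: cvg_id.
- by apply: continuous_integrable => v; apply: cvgM; exact: continuous_g_fun.
Qed.

Section lower_bound.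
Variable C : R -> R -> R.
Hypothesis copC : copula C.
Hypothesis betaC : blomqvist_beta C = b.

(* Deviation of the midpoint value from independence. *)
Let dev v := C 2^-1 v - v / 2.

(* Height of C u v above the chord of u |-> C u v over the half containing u. *)
Let w u v := if u <= 2^-1 then C u v - 2 * u * C 2^-1 v
  else C u v - C 2^-1 v - (2 * u - 1) * (v - C 2^-1 v).

Let energy_lb u v : u \in `[0, 1] -> v \in `[0, 1] ->
  v ^+ 2 + 4 * dev v ^+ 2 + 8 * w u v ^+ 2 <= energy (C ^~ v) 0 1.
Proof.
move=> u01 v01; have hL := copula_slope01l copC v01.
have [_ _ Cv _] := copC; have [C0 C1] := Cv _ v01.
have h0 : (0 : R) <= 2^-1 by lra.
have h1 : (2^-1 : R) <= 1 by lra.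
rewrite (energy_split hL in01_0 in01_half in01_1)//.
rewrite /dev /w; move: u01; rewrite in01 => /andP[u0 u1]; case: ifPn => [uh|].
  have u01 : u \in `[0, 1] by rewrite in01 u0.
  have := energy_refined hL in01_0 u01 in01_half u0 uh _.
  have := energy_refined hL in01_half in01_1 in01_1 h1 (lexx _) _.
  rewrite C0 C1 !subr0 => A1 A2; apply: le_trans (lerD (A2 _) (A1 _)); try lra.
  rewrite le_eqVlt; apply/orP; left; apply/eqP; by field.
rewrite -ltNge => uh.
have u01 : u \in `[0, 1] by rewrite in01 u0.
have := energy_refined hL in01_half u01 in01_1 (ltW uh) u1 _.
have := energy_refined hL in01_0 in01_half in01_half h0 (lexx _) _.
rewrite C0 C1 !subr0 => A1 A2; apply: le_trans (lerD (A1 _) (A2 _)); try lra.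
rewrite le_eqVlt; apply/orP; left; apply/eqP; by field.
Qed.

Let dev_half : dev 2^-1 = b / 4.
Proof. by move: betaC; rewrite /blomqvist_beta /dev; lra. Qed.

Let dev_lip v : v \in `[0, 1] -> `|dev v - b / 4| <= `|v - 2^-1| / 2.
Proof.
move=> v01; rewrite -dev_half /dev.
have L := copula_slope01r copC in01_half.
have [vh|vh] := leP v 2^-1.
  have := L _ _ v01 in01_half vh.
  rewrite (_ : `|v - 2^-1| = 2^-1 - v); last by rewrite ler0_norm; lra.
  by rewrite ler_norml => /andP[? ?]; apply/andP; split; lra.
have := L _ _ in01_half v01 (ltW vh).
rewrite (_ : `|v - 2^-1| = v - 2^-1); last by rewrite ger0_norm; lra.
by rewrite ler_norml => /andP[? ?]; apply/andP; split; lra.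
Qed.

Let sqr_dev v : v \in `[0, 1] -> g_fun b v ^+ 2 <= 4 * dev v ^+ 2.
Proof.
move=> v01; rewrite sqr_g_fun; have := dev_lip v01.
set s := `|v - 2^-1| => H; case: (leP (r / 2 - s) 0) => rs.
  by rewrite expr0n/= mulr_ge0// sqr_ge0.
have : r / 2 - s <= 2 * `|dev v|.
  have : `|b / 4| <= `|dev v| + `|dev v - b / 4|.
    by rewrite -{1}[b / 4](subKr (dev v)); exact: ler_normB.
  rewrite normrM (ger0_norm (_ : 0 <= 4^-1 :> R))// -/r; lra.
move=> rs'; have -> : 4 * dev v ^+ 2 = (2 * `|dev v|) ^+ 2.
  by rewrite exprMn real_normK ?num_real//; ring.
by rewrite ler_sqr// nnegrE; [exact: ltW|apply: le_trans rs'; exact: ltW].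
Qed.

(* The squares leave open dev v = - g_b(v) / 2; where g_b does not vanish, this is
   too far from b / 4 for the Lipschitz bound. *)
Let dev_g_fun v : v \in `[0, 1] -> 4 * dev v ^+ 2 = g_fun b v ^+ 2 ->
  dev v = g_fun b v / 2.
Proof.
move=> /dev_lip dl dg.
have /eqP : (2 * dev v) ^+ 2 = g_fun b v ^+ 2 by rewrite exprMn -dg; ring.
rewrite eqf_sqr => /orP[/eqP|/eqP dN]; first by lra.
have [/eqP g0|gneq0] := boolP (g_fun b v == 0); first by move: dN; rewrite g0; lra.
move: gneq0 dN; rewrite /g_fun; case: (leP (`|b| / 2 - `|v - 2^-1|) 0) => [_|].
  by rewrite mulr0 eqxx.
move=> rs _ dN; move: dl dN rs; rewrite ler_norml; set s := `|v - _|.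
by case: (sgrP b) => [b0|b0|b0]; lra.
Qed.

(** The energy of the section at v is at least v^2 + 4 dev(v)^2, and dev is
    1/2-Lipschitz with value b / 4 at 1/2, so 4 dev^2 >= g_b^2. *)
Lemma xi_ge : `|b| ^+ 3 / 2 <= chatterjee_xi C.
Proof.
have : \int[mu]_(v in `[0, 1]) (v ^+ 2 + g_fun b v ^+ 2) <=
       \int[mu]_(v in `[0, 1]) energy (C ^~ v) 0 1.
  apply: le_Rintegral_energy => // v v01; apply/andP; split.
    by rewrite addr_ge0// sqr_ge0.
  apply: le_trans (energy_lb in01_0 v01).
  by rewrite -addrA lerD2l (le_trans (sqr_dev v01))// lerDl mulr_ge0// sqr_ge0.
rewrite Rintegral_sqrD_g_fun xiE -/r; lra.
Qed.

(** Equality leaves no room for the excess [e], a continuous function, so that it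
    vanishes at every v and not only at almost every v. *)
Lemma xi_min_unique :
  chatterjee_xi C = `|b| ^+ 3 / 2 -> eq_on_square C (L_copula b).
Proof.
rewrite xiE -/r => xiC u v u01 v01.
pose e v := 4 * dev (clamp01 v) ^+ 2 - g_fun b (clamp01 v) ^+ 2
  + 8 * w u (clamp01 v) ^+ 2.
have cclamp := @continuous_clamp01 R.
have cg : continuous (fun v => g_fun b (clamp01 v)).
  by move=> x; apply: continuous_comp; [exact: cclamp|exact: continuous_g_fun].
have ce : continuous e.
  have cCh := copula_continuous_clamp copC in01_half.
  have cCu := copula_continuous_clamp copC u01.
  have cdev : continuous (fun v => dev (clamp01 v)).
    move=> x; apply: cvgB; first exact: cCh.
    by apply: cvgM; [exact: cclamp|exact: cvg_cst].
  have cw : continuous (fun v => w u (clamp01 v)).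
    move=> x; rewrite /w; case: (u <= 2^-1).
      by apply: cvgB; [exact: cCu|apply: cvgM; [exact: cvg_cst|exact: cCh]].
    apply: cvgB; first by apply: cvgB; [exact: cCu|exact: cCh].
    apply: cvgM; first exact: cvg_cst.
    by apply: cvgB; [exact: cclamp|exact: cCh].
  have csq (f : R -> R) c : continuous f -> continuous (fun v => c * f v ^+ 2).
    move=> cf x; apply: cvgM; first exact: cvg_cst.
    by apply: cvgM; exact: cf.
  move=> x; apply: cvgD; last exact: (csq _ 8 cw x).
  by apply: cvgB; [exact: (csq _ 4 cdev x)|apply: cvgM; exact: cg].
have e0 x : 0 <= e x.
  apply: addr_ge0; last by rewrite mulr_ge0// sqr_ge0.
  by rewrite subr_ge0; exact/sqr_dev/clamp01_in.
have e_eq0 : {in `[0, 1], forall x, e x = 0}.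
  apply: continuous_ge0_Rintegral_eq0 => //.
  have : \int[mu]_(v in `[0, 1]) ((v ^+ 2 + g_fun b v ^+ 2) + e v) <=
       \int[mu]_(v in `[0, 1]) energy (C ^~ v) 0 1.
    apply: le_Rintegral_energy => // x x01; apply/andP; split.
      by rewrite addr_ge0// addr_ge0// sqr_ge0.
    apply: le_trans (energy_lb u01 x01); rewrite /e clamp01_id//; lra.
  rewrite RintegralD//.
  - rewrite Rintegral_sqrD_g_fun; move: xiC; lra.
  - apply: continuous_integrable => x.
    by apply: cvgD; apply: cvgM; try exact: cvg_id; exact: continuous_g_fun.
  - exact: continuous_integrable.
have := e_eq0 _ v01; rewrite /e clamp01_id// => /eqP.
have w2 : 0 <= 8 * w u v ^+ 2 by rewrite mulr_ge0// sqr_ge0.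
rewrite paddr_eq0 ?subr_ge0 ?sqr_dev//.
rewrite subr_eq0 mulf_eq0 sqrf_eq0 => /andP[/eqP dg /orP[|/eqP w0]]; first by lra.
have Dg : dev v = g_fun b v / 2 by exact: dev_g_fun.
move: w0 Dg; rewrite /w /dev /L_copula /tent; case: ifPn => [uh|].
  by rewrite min_l; [move=> w0 Dg|lra]; nra.
by rewrite -ltNge => uh; rewrite min_r; [move=> w0 Dg|lra]; nra.
Qed.

End lower_bound.
End LeftBoundary.

(** * The copula of a rotation, and its mixtures with L_b *)

Section ShiftCopula.
Context (R : realType).
Notation mu := (@lebesgue_measure R).
Hint Resolve in01_0 in01_1 in01_half : core.

(** The distribution function of (U, U + th modulo 1): the two terms are the
    contributions of U <= 1 - th and of U > 1 - th. *)
Definition shift_copula (th u v : R) : R :=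
  Num.min u (Num.max 0 (v - th)) + Num.min (Num.max 0 (u - (1 - th))) v.

Lemma min_2increasing (x1 x2 y1 y2 : R) : x1 <= x2 -> y1 <= y2 ->
  0 <= Num.min x2 y2 - Num.min x1 y2 - Num.min x2 y1 + Num.min x1 y1.
Proof.
move=> x12 y12; case: (leP x2 y2) => ?; case: (leP x1 y2) => ?;
  case: (leP x2 y1) => ?; case: (leP x1 y1) => ?; lra.
Qed.

Lemma max_nondecreasing (c x y : R) : x <= y -> Num.max c x <= Num.max c y.
Proof. by move=> xy; case: (leP c x) => ?; case: (leP c y) => ?; lra. Qed.

Lemma copula_shift th : 0 <= th <= 1 -> copula (shift_copula th).
Proof.
move=> /andP[th0 th1].
apply: copula_2increasing => [u|v|u1 v1 u2 v2 u10 u1v1 v11 u20 u2v2 v21].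
- rewrite in01 /shift_copula => /andP[u0 u1].
  split.
    by case: (leP 0 (0 - th)) => ?; case: (leP 0 (u - (1 - th))) => ?;
      rewrite ?min_r//; lra.
  rewrite (max_r (_ : 0 <= 1 - th)); last by lra.
  by case: (leP 0 (u - (1 - th))) => ?; case: (leP u (1 - th)) => ?;
    rewrite min_l; lra.
- rewrite in01 /shift_copula => /andP[v0 v1]; split.
    rewrite (max_l (_ : 0 - (1 - th) <= 0)); last by lra.
    by rewrite !min_l ?addr0// le_max lexx.
  rewrite (max_r (_ : 0 <= 1 - (1 - th))); last by lra.
  by case: (leP 0 (v - th)) => ?; rewrite [X in X + _]min_r; try lra;
    case: (leP (1 - (1 - th)) v) => ?; lra.
rewrite /shift_copula.
have := @min_2increasing u1 v1 (Num.max 0 (u2 - th)) (Num.max 0 (v2 - th)) u1v1.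
have le1 : Num.max 0 (u2 - th) <= Num.max 0 (v2 - th).
  by apply: max_nondecreasing; lra.
have le2 : Num.max 0 (u1 - (1 - th)) <= Num.max 0 (v1 - (1 - th)).
  by apply: max_nondecreasing; lra.
move=> /(_ le1); have := @min_2increasing _ _ u2 v2 le2 u2v2.
lra.
Qed.

(** For fixed v the rotation maps a union of two intervals to [0,v], and the section
    grows at unit speed there and is constant elsewhere. *)
Lemma shift_copula_derive1 th v : 0 <= th <= 1 -> v \in `[0, 1] ->
  {ae mu, forall x, x \in `]0, 1[ ->
    derive1 (shift_copula th ^~ v) x = 0 \/ derive1 (shift_copula th ^~ v) x = 1}.
Proof.
rewrite in01 => /andP[th0 th1] /andP[v0 v1].
pose c := Num.max 0 (v - th); pose a := 1 - th.
have [c0 ca] : 0 <= c /\ c <= a.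
  by rewrite /c /a; case: (leP 0 (v - th)) => ?; lra.
apply: ae_imply2 (ae_neq c) (ae_imply2 (fun x => @conj _ _) (ae_neq a) (ae_neq (a + v))).
move=> x xc [xa xav]; rewrite in_itv/= => /andP[x0 x1].
have E y : shift_copula th y v =
    Num.min y c + Num.min (Num.max 0 (y - a)) v by [].
have [xltc|cltx|/eqP] := ltgtP x c; last by rewrite (negbTE xc).
- right; apply: (@derive1_near_affine _ _ _ 0).
  near=> y; rewrite E; have yc : y < c by near: y; exact: lt_nbhsl.
  by rewrite min_l ?(ltW yc)// max_l; [rewrite min_l//; lra|lra].
have [xlta|altx|/eqP] := ltgtP x a; last by rewrite (negbTE xa).
- left; apply: (@derive1_near_affine _ _ _ c).
  near=> y; rewrite E; have ya : y < a by near: y; exact: lt_nbhsl.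
  have cy : c < y by near: y; exact: lt_nbhsr.
  by rewrite min_r ?(ltW cy)// max_l; [rewrite min_l//; lra|lra].
have [xltv|vltx|/eqP] := ltgtP x (a + v); last by rewrite (negbTE xav).
- right; apply: (@derive1_near_affine _ _ _ (c - a)).
  near=> y; rewrite E; have yv : y < a + v by near: y; exact: lt_nbhsl.
  have ay : a < y by near: y; exact: lt_nbhsr.
  by rewrite min_r; [rewrite max_r; [rewrite min_l|]|]; lra.
left; apply: (@derive1_near_affine _ _ _ (c + v)).
near=> y; rewrite E; have vy : a + v < y by near: y; exact: lt_nbhsr.
by rewrite min_r; [rewrite max_r; [rewrite min_r|]|]; lra.
Unshelve. all: by end_near. Qed.


Section mixture.
Variable b : R.
Hypothesis b1 : -1 <= b <= 1.

Let th := (1 - b) / 4.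
Let th01 : 0 <= th <= 1.
Proof. by have := b1; rewrite /th => /andP[? ?]; apply/andP; split; lra. Qed.

Definition boundary_mixture (t u v : R) : R :=
  (1 - t) * L_copula b u v + t * shift_copula ((1 - b) / 4) u v.

Lemma shift_copula_half : shift_copula th 2^-1 2^-1 = (1 + b) / 4.
Proof.
have /andP[b1l b1r] := b1; rewrite /shift_copula /th.
rewrite (@max_r _ _ 0 (2^-1 - (1 - b) / 4)); last by lra.
rewrite (@max_l _ _ 0 (2^-1 - (1 - (1 - b) / 4))); last by lra.
by rewrite (@min_r _ _ 2^-1 (2^-1 - _)) ?(@min_l _ _ 0 2^-1); lra.
Qed.

Lemma beta_shift : blomqvist_beta (shift_copula th) = b.
Proof. by rewrite /blomqvist_beta shift_copula_half; field. Qed.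

Lemma beta_mixture t : blomqvist_beta (boundary_mixture t) = b.
Proof.
have := beta_L b; have := beta_shift; rewrite /blomqvist_beta /boundary_mixture -/th.
set x := L_copula _ _ _; set y := shift_copula _ _ _ => /eqP + /eqP.
by rewrite !subr_eq => /eqP yE /eqP xE; rewrite mulrDr !(mulrCA 4) xE yE; ring.
Qed.

Lemma copula_mixture t : 0 <= t <= 1 -> copula (boundary_mixture t).
Proof.
move=> t01; apply: copula_convex => //; first exact: copula_L.
exact: copula_shift.
Qed.

(* The integral over u of the product of the u-derivatives of L_b and of the shift
   copula: the former is v + g_b(v) before 1/2 and v - g_b(v) after it. *)
Let cross v := (v + g_fun b v) * shift_copula th 2^-1 v +
  (v - g_fun b v) * (v - shift_copula th 2^-1 v).

(** The derivative of the shift copula is its own square, so the square of the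
    derivative of the mixture is affine in it on each half. *)
Lemma energy_mixture t v : 0 <= t <= 1 -> v \in `[0, 1] ->
  energy (boundary_mixture t ^~ v) 0 1 =
  (1 - t) ^+ 2 * (v ^+ 2 + g_fun b v ^+ 2) + 2 * t * (1 - t) * cross v + t ^+ 2 * v.
Proof.
move=> t01 v01.
have copD := copula_shift th01.
have DL := copula_slope01l copD v01.
have [_ _ Dv _] := copD; have [D0 D1] := Dv _ v01.
have h0 : (0 : R) <= 2^-1 by lra.
have h1 : (2^-1 : R) <= 1 by lra.
have ML := copula_slope01l (copula_mixture t01) v01.
rewrite (energy_split ML in01_0 in01_half in01_1)//.
set g := g_fun b v.
have D01 := shift_copula_derive1 th01 v01.
rewrite (@energy_affine _ _ DL _ _ _ ((1 - t) ^+ 2 * (v + g) ^+ 2)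
  (2 * t * (1 - t) * (v + g) + t ^+ 2))//; last first.
  apply: ae_imply2 (ae_neq 2^-1) D01 => x xh D01 x01 xab dx.
  have {xab}xh : x < 2^-1.
    by rewrite lt_neqAle xh; move: xab; rewrite in_itv => /andP[].
  have [||_ ->] := @derivable_near_affineD _ (boundary_mixture t ^~ v)
    (shift_copula th ^~ v) x 0 ((1 - t) * (v + g)) t => //; last first.
    by have [->|->] := D01 x01; ring.
  near=> y; rewrite /boundary_mixture /L_copula /tent -/th -/g.
  have yh : y < 2^-1 by near: y; exact: lt_nbhsl.
  by rewrite min_l; [ring|lra].
rewrite (@energy_affine _ _ DL _ _ _ ((1 - t) ^+ 2 * (v - g) ^+ 2)
  (2 * t * (1 - t) * (v - g) + t ^+ 2))//; last first.
  apply: ae_imply2 (ae_neq 2^-1) D01 => x xh D01 x01 xab dx.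
  have {xab}xh : 2^-1 < x.
    by rewrite lt_neqAle eq_sym xh; move: xab; rewrite in_itv => /andP[].
  have [||_ ->] := @derivable_near_affineD _ (boundary_mixture t ^~ v)
    (shift_copula th ^~ v) x ((1 - t) * g) ((1 - t) * (v - g)) t => //; last first.
    by have [->|->] := D01 x01; ring.
  near=> y; rewrite /boundary_mixture /L_copula /tent -/th -/g.
  have yh : 2^-1 < y by near: y; exact: lt_nbhsr.
  by rewrite min_r; [ring|lra].
by rewrite D0 D1 /cross -/g; field.
Unshelve. all: by end_near. Qed.

(** [B] carries the average of [cross] over v; the constant term is the value of xi
    at L_b, and the coefficient of t^2 makes the value at t = 1 equal to 1. *)
Lemma xi_mixture : exists B, forall t, 0 <= t <= 1 ->
  chatterjee_xi (boundary_mixture t) =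
    `|b| ^+ 3 / 2 + B * t + (1 - `|b| ^+ 3 / 2 - B) * t ^+ 2.
Proof.
pose K := \int[mu]_(v in `[0, 1]) cross (clamp01 v).
exists (12 * K - `|b| ^+ 3 - 4) => t t01; rewrite xiE.
pose base v := v ^+ 2 + g_fun b v ^+ 2.
have cbase : continuous base.
  by move=> x; apply: cvgD; apply: cvgM; try exact: cvg_id; exact: continuous_g_fun.
have ccross : continuous (fun v => cross (clamp01 v)).
  have cc := @continuous_clamp01 R.
  have cD := copula_continuous_clamp (copula_shift th01) in01_half.
  have cg : continuous (fun v => g_fun b (clamp01 v)).
    by move=> x; apply: continuous_comp; [exact: cc|exact: continuous_g_fun].
  move=> x; apply: cvgD; apply: cvgM; try exact: cD.
  - by apply: cvgD; [exact: cc|exact: cg].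
  - by apply: cvgB; [exact: cc|exact: cg].
  - by apply: cvgB; [exact: cc|exact: cD].
have cZ (f : R -> R) c : continuous f -> continuous (fun v => c * f v).
  by move=> cf x; apply: cvgM; [exact: cvg_cst|exact: cf].
have cid : continuous (@idfun R) by move=> x; exact: cvg_id.
have -> : \int[mu]_(v in `[0, 1]) energy (boundary_mixture t ^~ v) 0 1 =
    \int[mu]_(v in `[0, 1]) ((1 - t) ^+ 2 * base v +
      2 * t * (1 - t) * cross (clamp01 v) + t ^+ 2 * idfun v).
  apply: eq_Rintegral => v; rewrite inE /= => v01.
  by rewrite energy_mixture// clamp01_id.
have i1 := continuous_integrable 0 1 (cZ _ ((1 - t) ^+ 2) cbase).
have i2 := continuous_integrable 0 1 (cZ _ (2 * t * (1 - t)) ccross).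
have i3 := continuous_integrable 0 1 (cZ _ (t ^+ 2) cid).
rewrite RintegralD//; last first.
  apply: continuous_integrable => x.
  apply: cvgD; first exact: (cZ _ ((1 - t) ^+ 2) cbase).
  exact: (cZ _ (2 * t * (1 - t)) ccross).
rewrite RintegralD// !RintegralZl//; try exact: continuous_integrable.
rewrite Rintegral_sqrD_g_fun//.
have -> : \int[mu]_(v in `[0, 1]) idfun v = 2^-1 :> R.
  transitivity (\int[mu]_(v in `[0, 1]) (0 + 1 * v + 0 * v ^+ 2)).
    by apply: eq_Rintegral => v _ /=; ring.
  by rewrite Rintegral_quadratic//; field.
by rewrite -/K; field.
Qed.

End mixture.
End ShiftCopula.

(** * The rotation of the unit interval *)

Section ShiftMap.
Context (R : realType).
Notation mu := (@lebesgue_measure R).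

Definition translation (c x : R) := x + c.

Lemma measurable_translation c : measurable_fun setT (translation c).
Proof. exact: measurable_funD. Qed.

Lemma lebesgue_measure_translation (c : R) (A : set R) : measurable A ->
  mu (translation c @^-1` A) = mu A.
Proof.
move=> mA; apply/esym.
pose tr : measurableTypeR R -> measurableTypeR R := translation c.
have mtr : measurable_fun setT tr by exact: measurable_translation.
apply: (@lebesgue_measure_unique _ (pushforward mu tr)) => //= _ [[x y] _ <-].
transitivity (mu (`]x - c, y - c]%classic : set R)); last first.
  congr mu; apply/seteqP; split => z /=; rewrite !in_itv/= /translation.
    by rewrite ltrBlDr lerBrDr.
  by rewrite ltrBlDr lerBrDr.
rewrite !lebesgue_measure_itv/= !lte_fin ltrD2r -!EFinD.
by case: ifP => // _; congr (_%:E); ring.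
Qed.

Definition shift_map (th x : R) : R :=
  if x <= 1 - th then x + th else x + th - 1.

Lemma measurable_shift_map th : measurable_fun setT (shift_map th).
Proof.
apply: measurable_fun_ifT => //=.
- exact: measurable_fun_ler.
- exact: measurable_funD.
- by apply: measurable_funB => //; exact: measurable_funD.
Qed.

HB.instance Definition _ th :=
  isMeasurableFun.Build _ _ _ _ (shift_map th) (measurable_shift_map th).

(** Half-open intervals ]a, b] are the ones that the rotation cuts and glues without
    double points. *)
Lemma lebesgue_measure_cc_oc (a b : R) (A : set R) : measurable A ->
  mu (`[a, b] `&` A) = mu (`]a, b] `&` A).
Proof.
move=> mA; apply/eqP; rewrite eq_le; apply/andP; split; last first.
  apply: le_measure; rewrite ?inE; try exact: measurableI.
  by apply: setSI; exact: subset_itv_oc_cc.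
have sub : `[a, b] `&` A `<=` (`]a, b] `&` A) `|` [set a].
  move=> x [] /=; rewrite !in_itv/= le_eqVlt => /andP[/orP[/eqP<-|ax] xb] Ax.
    by right.
  by left; split => //; rewrite ax.
apply: (@le_trans _ _ (mu ((`]a, b] `&` A) `|` [set a]))).
  apply: le_measure; rewrite ?inE //.
  - exact: measurableI.
  - by apply: measurableU => //; exact: measurableI.
apply: le_trans (measureU2 _ _ _) _ => //; first exact: measurableI.
rewrite -[leRHS]adde0; apply: leeD2l; rewrite le_eqVlt; apply/orP; left.
exact/eqP/lebesgue_measure_set1.
Qed.

Lemma uniform_prob01E (A : set R) : measurable A ->
  uniform_prob (@ltr01 R) A = mu (`]0, 1] `&` A).
Proof.
move=> mA; rewrite -lebesgue_measure_cc_oc//.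
rewrite /uniform_prob integral_uniform_pdf setIC.
transitivity (\int[mu]_(x in `[0%R, 1%R] `&` A) (1%:E : \bar R))%E.
  apply: eq_integral => x; rewrite inE => -[/=]; rewrite in_itv/= => x01 _.
  by rewrite /uniform_pdf x01 subr0 invr1.
by rewrite integral_cst ?mul1e//; exact: measurableI.
Qed.

Section shift.
Variable th : R.
Hypothesis th01 : 0 <= th <= 1.

Let mu_setI_oc (a : R) (S : set R) : 0 <= a -> a <= 1 -> measurable S ->
  mu (`]0, 1] `&` S) = (mu (`]0%R, a] `&` S) + mu (`]a, 1%R] `&` S))%E.
Proof.
move=> a0 a1 mS.
have -> : `]0, 1] `&` S = (`]0, a] `&` S) `|` (`]a, 1] `&` S).
  rewrite -setIUl; congr (_ `&` S).
  by apply: (@itv_bndbnd_setU _ _ (BRight 0) (BRight a) (BRight 1)); rewrite bnd_simp.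
rewrite measureU//; try exact: measurableI.
apply/seteqP; split => // x [[/= + _] [+ _]].
rewrite !in_itv/= => /andP[_ xa] /andP[ax _].
by move: (lt_le_trans ax xa); rewrite ltxx.
Qed.

Lemma lebesgue_measure_shift_map (A : set R) : measurable A ->
  mu (`]0, 1] `&` shift_map th @^-1` A) = mu (`]0, 1] `&` A).
Proof.
move=> mA; have /andP[th0 th1] := th01.
have mf : measurable (shift_map th @^-1` A).
  by rewrite -[X in measurable X]setTI; exact: measurable_shift_map.
rewrite (@mu_setI_oc (1 - th))//; [|lra..].
rewrite [RHS](@mu_setI_oc th)// addeC.
have -> : `]0, 1 - th] `&` shift_map th @^-1` A =
    translation th @^-1` (`]th, 1] `&` A).
  apply/seteqP; split => x /=; rewrite !in_itv/= /shift_map /translation.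
    by move=> [/andP[x0 x1]]; rewrite x1 => Ax; split => //; apply/andP; split; lra.
  move=> [/andP[x0 x1] Ax]; have x1' : x <= 1 - th by lra.
  by rewrite x1'; split => //; apply/andP; split; lra.
have -> : `]1 - th, 1] `&` shift_map th @^-1` A =
    translation (th - 1) @^-1` (`]0, th] `&` A).
  apply/seteqP; split => x /=; rewrite !in_itv/= /shift_map /translation.
    move=> [/andP[x0 x1]]; rewrite leNgt x0/= addrA => Ax.
    by split => //; apply/andP; split; lra.
  move=> [/andP[x0 x1]]; have x1' : 1 - th < x by lra.
  by rewrite (leNgt x (1 - th)) x1'/= addrA => Ax; split => //; lra.
by rewrite !lebesgue_measure_translation//; exact: measurableI.
Qed.

Lemma preserves_shift_map : preserves_lebesgue01 (shift_map th : {mfun R >-> R}).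
Proof.
have /andP[th0 th1] := th01; split.
  move=> x; rewrite !in01 /= /shift_map => /andP[x0 x1].
  by case: ifPn => [?|]; [|rewrite -ltNge => ?]; apply/andP; split; lra.
move=> A mA A01.
rewrite lebesgue_measure_cc_oc; last first.
  by rewrite -[X in measurable X]setTI; exact: measurable_shift_map.
by rewrite lebesgue_measure_shift_map// -lebesgue_measure_cc_oc// setIidr.
Qed.

Let measurable_lower_set u v :
  measurable [set x | x <= u /\ shift_map th x <= v].
Proof.
rewrite (_ : mkset _ = `]-oo, u] `&` shift_map th @^-1` `]-oo, v]).
  apply: measurableI => //.
  by rewrite -[X in measurable X]setTI; exact: measurable_shift_map.
by apply/seteqP; split => x /=; rewrite !in_itv.
Qed.

Lemma shift_map_cdf u v : u \in `[0, 1] -> v \in `[0, 1] ->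
  mu (`]0, 1] `&` [set x | x <= u /\ shift_map th x <= v]) =
  (shift_copula th u v)%:E.
Proof.
rewrite !in01 => /andP[u0 u1] /andP[v0 v1]; have /andP[th0 th1] := th01.
rewrite (@mu_setI_oc (1 - th))//; [|lra..].
rewrite /shift_copula EFinD; congr (_ + _)%E.
  have -> : `]0, 1 - th] `&` [set x | x <= u /\ shift_map th x <= v] =
      `]0, Num.min u (v - th)]%classic.
    apply/seteqP; split => x /=; rewrite !in_itv/= /shift_map le_min.
      move=> [/andP[x0 x1] [xu]]; rewrite x1 => xv.
      by apply/and3P; split => //; lra.
    move=> /and3P[x0 xu xv]; have x1 : x <= 1 - th by lra.
    by rewrite x0 x1; split => //; split => //; lra.
  rewrite lebesgue_measure_itv/= lte_fin oppr0 adde0.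
  by case: (leP 0 (v - th)) => ?; case: (leP u (v - th)) => ?;
    case: ltP => ?; congr EFin; rewrite ?min_r; lra.
have -> : `]1 - th, 1] `&` [set x | x <= u /\ shift_map th x <= v] =
    `]1 - th, Num.min u (v + (1 - th))]%classic.
  apply/seteqP; split => x /=; rewrite !in_itv/= /shift_map le_min.
    move=> [/andP[x0 x1] [xu]]; rewrite (leNgt x (1 - th)) x0/= xu => xv; lra.
  move=> /and3P[x0 xu xv]; rewrite (leNgt x (1 - th)) x0/=.
  by split; [lra|split => //; lra].
rewrite lebesgue_measure_itv/= lte_fin -EFinB.
case: (leP 0 (u - (1 - th))) => ?; last first.
  by rewrite (min_l v0) min_l; [case: ltP => ?; congr EFin; lra|lra].
by case: (leP u (v + (1 - th))) => ?; case: (leP (u - (1 - th)) v) => ?;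
  case: ltP => ?; congr EFin; lra.
Qed.

Lemma copula_of_shift_map (d : measure_display) (T : measurableType d)
    (P : probability T R) (U : {RV P >-> R}) : uniform01 U ->
  copula_of U ((shift_map th \o U : {mfun T >-> R}) : {RV P >-> R})
    (shift_copula th).
Proof.
move=> Uunif.
have mpre (A : set R) : measurable A -> measurable (shift_map th @^-1` A).
  by move=> mA; rewrite -[X in measurable X]setTI; exact: measurable_shift_map.
split => //.
- move=> A mA.
  transitivity (distribution P U (shift_map th @^-1` A)) => //.
  by rewrite Uunif ?uniform_prob01E ?lebesgue_measure_shift_map//; exact: mpre.
- exact: copula_shift.
move=> u v u01 v01.
transitivity (distribution P U [set x | x <= u /\ shift_map th x <= v]) => //.
by rewrite Uunif// uniform_prob01E// shift_map_cdf.
Qed.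

End shift.
End ShiftMap.

(** * The attainable region *)

Section Region.
Context (R : realType).
Hint Resolve in01_0 in01_1 in01_half : core.

Lemma beta_bounds (C : R -> R -> R) : copula C -> -1 <= blomqvist_beta C <= 1.
Proof.
move=> copC; have h0 : (0 : R) <= 2^-1 by lra.
have := copula_slope01r copC in01_half in01_0 in01_half h0.
have [_ Cu _ _] := copC; have [-> _] := Cu _ in01_half.
rewrite /blomqvist_beta => /andP[? ?]; apply/andP; split; lra.
Qed.

Lemma xi_le1 (C : R -> R -> R) : copula C -> chatterjee_xi C <= 1.
Proof. by move=> /Rintegral_energy_le; rewrite xiE; lra. Qed.

Lemma boundary_mixture0 (b : R) : boundary_mixture b 0 = L_copula b.
Proof.
by apply/funext => u; apply/funext => v; rewrite /boundary_mixture; ring.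
Qed.

Lemma boundary_mixture1 (b : R) : boundary_mixture b 1 = shift_copula ((1 - b) / 4).
Proof.
by apply/funext => u; apply/funext => v; rewrite /boundary_mixture; ring.
Qed.

Lemma xi_L (b : R) : -1 <= b <= 1 -> chatterjee_xi (L_copula b) = `|b| ^+ 3 / 2.
Proof.
move=> b1; have [B xiB] := xi_mixture b1.
by rewrite -boundary_mixture0 xiB ?lexx ?ler01//; ring.
Qed.

Lemma xi_shift (b : R) : -1 <= b <= 1 ->
  chatterjee_xi (shift_copula ((1 - b) / 4)) = 1.
Proof.
move=> b1; have [B xiB] := xi_mixture b1.
by rewrite -boundary_mixture1 xiB ?lexx ?ler01//; ring.
Qed.

Lemma xi_mixture_onto (b x : R) : -1 <= b <= 1 -> `|b| ^+ 3 / 2 <= x <= 1 ->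
  exists2 t, 0 <= t <= 1 & chatterjee_xi (boundary_mixture b t) = x.
Proof.
move=> b1 /andP[xl xr]; have [B xiB] := xi_mixture b1.
set c := `|b| ^+ 3 / 2 in xl xiB.
pose p : {poly R} := c%:P + B *: 'X + (1 - c - B) *: 'X^2.
have pE t : p.[t] = c + B * t + (1 - c - B) * t ^+ 2.
  by rewrite /p !(hornerD, hornerZ, hornerC, hornerXn, hornerX).
have p0 : p.[0] = c by rewrite pE; ring.
have p1 : p.[1] = 1 by rewrite pE; ring.
have [|||t t01 pt] := @IVT R (horner p) 0 1 x.
- exact: ler01.
- by apply: continuous_subspaceT => y; exact: continuous_horner.
- by rewrite p0 p1 ge_min le_max xl xr orbT.
by exists t; rewrite -?in01// xiB -?in01// -pE.
Qed.

End Region.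

Theorem theorem1 (R : realType) :
  [/\ [set (chatterjee_xi C, blomqvist_beta C) | C in @copula R] =
      [set p : R * R | [/\ 0 <= p.1 <= 1, -1 <= p.2 <= 1 &
                           `|p.2| ^+ 3 <= 2 * p.1]],
      (forall b : R, -1 <= b <= 1 ->
        [/\ copula (L_copula b),
            blomqvist_beta (L_copula b) = b,
            chatterjee_xi (L_copula b) = `|b| ^+ 3 / 2 &
            forall C : R -> R -> R, copula C ->
              blomqvist_beta C = b -> chatterjee_xi C = `|b| ^+ 3 / 2 ->
              eq_on_square C (L_copula b)]) &
      (forall b : R, -1 <= b <= 1 ->
        exists (f : {mfun R >-> R}) (D : R -> R -> R),
          [/\ preserves_lebesgue01 f, copula D,
              (forall (d : measure_display) (T : measurableType d)
                 (P : probability T R) (U : {RV P >-> R}),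
                 uniform01 U ->
                 copula_of U ((f \o U : {mfun T >-> R}) : {RV P >-> R}) D),
              chatterjee_xi D = 1 & blomqvist_beta D = b])].
Proof.
split.
- apply/seteqP; split => [_ [C copC <-]|[x y] /= [/andP[x0 x1] y1 xy]] /=.
    have b1 := beta_bounds copC; have xl := xi_ge b1 copC erefl.
    have b3 : 0 <= `|blomqvist_beta C| ^+ 3 by rewrite exprn_ge0.
    split => //; last by lra.
    by rewrite xi_le1// andbT; lra.
  have [|t t01 xit] := @xi_mixture_onto R y x y1; first by apply/andP; split; lra.
  exists (boundary_mixture y t); first exact: copula_mixture.
  by rewrite xit beta_mixture.
- move=> b b1; split; [exact: copula_L|exact: beta_L|exact: xi_L|].
  by move=> C copC betaC; exact: xi_min_unique.
- move=> b b1; have th01 : 0 <= (1 - b) / 4 <= 1 by case/andP: b1 => ? ?; lra.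
  exists (shift_map ((1 - b) / 4) : {mfun R >-> R}),
    (shift_copula ((1 - b) / 4)).
  split; [exact: preserves_shift_map|exact: copula_shift| |exact: xi_shift|
    exact: beta_shift].
  by move=> d T P U; exact: copula_of_shift_map.
Qed.
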